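(* Consider the $n$-DoF open chain manipulator in closed loop with the link observers, joint observers and controller described in the context. Let $\mathbf K_{\mathbf B_i}=K_{\mathbf B_i}I_{6\times6}$ and $\mathbf L_{\mathbf B_i}=L_{\mathbf B_i}I_{6\times6}$ with constants $K_{\mathbf B_i},L_{\mathbf B_i}>0$ for all $i\in\{1,\dots,n\}$. Suppose there are constants $M_{d,i},M'_{d,i}>0$ with $|q_{id}(t)|\le M_{d,i}$ and $|\dot q_{id}(t)|\le M'_{d,i}$ for all $t\ge0$ and all $i$. Let $M_{v,i}=\sup_{t>0}\|{}^{\mathbf B_i}V(t)\|<\infty$ denote the bound on the velocity of link $i$. Suppose that the gains are chosen such that, for all $i\in\{1,\dots,n\}$, $$\mathbf K_{\mathbf B_i}>I_{6\times6},\qquad \mathbf L_{\mathbf B_i}>M_{c,i}M_{v,i}\Big(1+\tfrac12M_{c,i}M_{v,i}\Big)I_{6\times6}+\tfrac12\mathbf K_{\mathbf B_i},$$ $$k_i>0,\qquad 2I_{m,i}L_i>\max\{2,\;m_{c,i}^2+k_i\},\qquad \ell_i=L_i-I_{m,i}^{-1}>0,\qquad \lambda_i>0.$$ Define $$\mathbf x^T=\Big[({}^{\mathbf B_i}V_r-{}^{\mathbf B_i}V)^T,\ ({}^{\mathbf B_i}\hat V-{}^{\mathbf B_i}V)^T,\ \dot q_{ir}-\dot q_i,\ \dot{\hat q}_i-\dot q_i,\ s_i\Big]_{i=1}^n,\qquad s_i=(\dot{\hat q}_i-\dot q_i)+\ell_i(\hat q_i-q_i),$$ $$\alpha_m=\min_{1\le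 i\le n}\min\{\min\sigma(\mathbf M_{\mathbf B_i}),\,I_{m,i}\},\qquad \alpha_M=\max_{1\le i\le n}\max\{\max\sigma(\mathbf M_{\mathbf B_i}),\,I_{m,i}+\ell_i^{-1}\},$$ $$M_U=\max\{1,\|{}^{\mathbf B_0}\mathbf U_{\mathbf B_1}\|,\|{}^{\mathbf B_1}\mathbf U_{\mathbf B_2}\|,\dots,\|{}^{\mathbf B_{n-1}}\mathbf U_{\mathbf B_n}\|\},$$ where $\sigma(\cdot)$ denotes the set of eigenvalues. Suppose $4\lambda_i>\alpha_M^{-1}$ for all $i$, and let the initial conditions satisfy $\hat q_i(0)=q_{id}(0)$ for all $i$ and $$\|\mathbf x(0)\|<\min_{i\in\{1,\dots,n\}}\left\{\sqrt{\frac{\alpha_m}{\alpha_M}}\;\frac{\dfrac{\sqrt{1+2L_{\mathbf B_i}-K_{\mathbf B_i}}-1}{M_{c,i}}-\displaystyle\sum_{k=1}^iM_U^kM'_{d,k}}{1+\displaystyle\sum_{k=1}^iM_U^k\frac{16\lambda_k}{4\lambda_k-\alpha_M^{-1}}}\right\}.$$ Then, for all $i\in\{1,\dots,n\}$, the tracking error $q_{id}(t)-q_i(t)$ decays exponentially to zero as $t\to\infty$, i.e. there are constants $C,\mu>0$ with $|q_{id}(t)-q_i(t)|\le Ce^{-\mu t}$ for all $t\ge0$.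
   Context: Norms are Euclidean norms of vectors and induced norms of matrices. For symmetric matrices, $A>B$ means $A-B$ is positive definite. All functions of time are smooth enough for the derivatives written below to exist. **Frames.** The manipulator has a fixed base with frame $\{\mathbf B_0\}$, $n$ rigid links and $n$ actuated joints. Link $i$ carries two body-fixed frames: $\{\mathbf B_i\}$ at its base and $\{\mathbf T_i\}$ at its tip. Joint $i$ connects link $i-1$ (the base if $i=1$) to link $i$. For a frame $\{\mathbf A\}$, ${}^{\mathbf A}V\in\mathbb R^6$ is the stacked linear velocity and angular velocity ${}^{\mathbf A}\omega\in\mathbb R^3$ of the frame, ${}^{\mathbf A}F\in\mathbb R^6$ is the stacked force and moment at its origin, both expressed in $\{\mathbf A\}$, and ${}^{\mathbf A}P\in\mathbb R^6$ is the position vector with $\frac{d}{dt}{}^{\mathbf A}P={}^{\mathbf A}V$. The $6\times6$ force/moment transformation matrix is ${}^{\mathbf A}\mathbf U_{\mathbf B}=\begin{bmatrix}R&0\\ (r\times)R&R\end{bmatrix}$, where $R$ is the rotation matrix from $\{\mathbf B\}$ to $\{\mathbf A\}$, $r$ is the vector from the origin of $\{\mathbf A\}$ to that of $\{\mathbf B\}$ expressed in $\{\mathbf A\}$, and $(r\times)$ is its cross product matrix. One has ${}^{\mathbf B_{i-1}}\mathbf U_{\mathbf B_i}={}^{\mathbf B_{i-1}}\mathbf U_{\mathbf T_{i-1}}{}^{\mathbf T_{i-1}}\mathbf U_{\mathbf B_i}$ for $i\ge2$. **Kinematics.** Let $q_i$ be the joint angles and $\mathbf z_\tau=[0,0,0,0,0,1]^T$.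 Then ${}^{\mathbf B_0}V=0$, ${}^{\mathbf B_i}V=\mathbf z_\tau\dot q_i+{}^{\mathbf B_{i-1}}\mathbf U_{\mathbf B_i}^T\,{}^{\mathbf B_{i-1}}V$ and ${}^{\mathbf T_i}V={}^{\mathbf B_i}\mathbf U_{\mathbf T_i}^T\,{}^{\mathbf B_i}V$ for $i=1,\dots,n$. **Link dynamics.** $\mathbf M_{\mathbf B_i}\frac{d}{dt}{}^{\mathbf B_i}V+\mathbf C_{\mathbf B_i}({}^{\mathbf B_i}\omega)\,{}^{\mathbf B_i}V+\mathbf G_{\mathbf B_i}={}^{\mathbf B_i}F^*$, where ${}^{\mathbf B_i}F^*$ is the net force/moment vector of link $i$, $\mathbf M_{\mathbf B_i}$ is the constant symmetric positive definite mass matrix, $\mathbf G_{\mathbf B_i}\in\mathbb R^6$ is the gravity vector, and $\mathbf C_{\mathbf B_i}(\cdot)\in\mathbb R^{6\times6}$ is the Coriolis/centrifugal matrix, which is linear in its argument, skew-symmetric, and satisfies $\|\mathbf C_{\mathbf B_i}(\omega)\|\le M_{c,i}\|\omega\|$ for all $\omega\in\mathbb R^3$, with $M_{c,i}>0$. Forces: ${}^{\mathbf B_i}F={}^{\mathbf B_i}F^*+{}^{\mathbf B_i}\mathbf U_{\mathbf T_i}{}^{\mathbf T_i}F$ for $i=1,\dots,n$, ${}^{\mathbf T_n}F=0$ (no external force), ${}^{\mathbf T_{i-1}}F={}^{\mathbf T_{i-1}}\mathbf U_{\mathbf B_i}{}^{\mathbf B_i}F$ for $i\ge2$, and ${}^{\mathbf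 B_0}F={}^{\mathbf B_0}\mathbf U_{\mathbf B_1}{}^{\mathbf B_1}F$. **Joint dynamics.** $\tau_i=I_{m,i}\ddot q_i+f_{c,i}(\dot q_i)+\tau_{ai}$ with $\tau_{ai}=\mathbf z_\tau^T\,{}^{\mathbf B_i}F$, where $\tau_i$ is the torque input, $I_{m,i}>0$ the joint moment of inertia, and $f_{c,i}:\mathbb R\to\mathbb R$ the friction function, which is increasing, antisymmetric (odd) and globally Lipschitz with Lipschitz constant $m_{c,i}$. **Available data.** Joint positions $q_i$ and joint torque data $\tau_i$ are available for the observer design for all $i$; velocities are not. **Link observer** (state ${}^{\mathbf B_i}\hat P,{}^{\mathbf B_i}Z$, gain $\mathbf L_{\mathbf B_i}>0$): ${}^{\mathbf B_i}\dot{\hat P}={}^{\mathbf B_i}Z-\mathbf M_{\mathbf B_i}^{-1}\mathbf L_{\mathbf B_i}({}^{\mathbf B_i}\hat P-{}^{\mathbf B_i}P)$ and $\mathbf M_{\mathbf B_i}{}^{\mathbf B_i}\dot Z={}^{\mathbf B_i}F^*-\mathbf C_{\mathbf B_i}({}^{\mathbf B_i}\hat\omega){}^{\mathbf B_i}\hat V-\mathbf G_{\mathbf B_i}$, where ${}^{\mathbf B_i}\hat V={}^{\mathbf B_i}\dot{\hat P}$ is the observed velocity and ${}^{\mathbf B_i}\hat\omega$ its angular part. **Joint observer** (state $\hat q_i,z_i$, gains $L_i,\ell_i>0$): $\dot{\hat q}_i=z_i-L_i(\hat q_i-q_i)$ and $I_{m,i}\dot z_i=\tau_i-\tau_{ai}-f_{c,i}(\dot{\hat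 q}_i)-\ell_i(\hat q_i-q_i)$. **Controller.** Let $q_{id}$ be the desired joint trajectories. The required velocities are $\dot q_{ir}=\dot q_{id}+\lambda_i(q_{id}-\hat q_i)$ with $\lambda_i>0$, ${}^{\mathbf B_0}V_r=0$, ${}^{\mathbf B_i}V_r=\mathbf z_\tau\dot q_{ir}+{}^{\mathbf B_{i-1}}\mathbf U_{\mathbf B_i}^T{}^{\mathbf B_{i-1}}V_r$, ${}^{\mathbf T_i}V_r={}^{\mathbf B_i}\mathbf U_{\mathbf T_i}^T{}^{\mathbf B_i}V_r$. The required forces are ${}^{\mathbf B_i}F_r^*=\mathbf M_{\mathbf B_i}\frac{d}{dt}{}^{\mathbf B_i}V_r+\mathbf C_{\mathbf B_i}({}^{\mathbf B_i}\hat\omega){}^{\mathbf B_i}V_r+\mathbf G_{\mathbf B_i}+\mathbf K_{\mathbf B_i}({}^{\mathbf B_i}V_r-{}^{\mathbf B_i}\hat V)$ with gain $\mathbf K_{\mathbf B_i}>0$, ${}^{\mathbf B_i}F_r={}^{\mathbf B_i}F_r^*+{}^{\mathbf B_i}\mathbf U_{\mathbf T_i}{}^{\mathbf T_i}F_r$, ${}^{\mathbf T_n}F_r=0$, ${}^{\mathbf T_{i-1}}F_r={}^{\mathbf T_{i-1}}\mathbf U_{\mathbf B_i}{}^{\mathbf B_i}F_r$ for $i\ge2$, ${}^{\mathbf B_0}F_r={}^{\mathbf B_0}\mathbf U_{\mathbf B_1}{}^{\mathbf B_1}F_r$. The control law is $\tau_i=I_{m,i}\ddot q_{ir}+f_{c,i}(\dot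 q_{ir})+\tau_{air}+k_i(\dot q_{ir}-\dot{\hat q}_i)$ with $\tau_{air}=\mathbf z_\tau^T{}^{\mathbf B_i}F_r$ and gain $k_i>0$. *)

(* Defs.v *)
From HB Require Import structures.
From mathcomp Require Import all_boot all_order all_algebra.
From mathcomp Require Import all_classical all_reals all_analysis.
Set Implicit Arguments.
Unset Strict Implicit.
Unset Printing Implicit Defensive.
Import Order.TTheory GRing.Theory Num.Theory.
Import numFieldNormedType.Exports.
Local Open Scope classical_set_scope.
Local Open Scope ring_scope.

(* The norm `|_| that MathComp-Analysis puts on matrices is the sup norm. It
   gives the same topology, hence the same derivatives, as the Euclidean norm,
   but quantitative statements must use enorm and opnorm below. *)

Section LinearAlgebra.
Variable R : realType.

Definition enorm (m : nat) (v : 'cV[R]_m) : R :=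
  Num.sqrt (\sum_(i < m) v i ord0 ^+ 2).

Definition opnorm (m p : nat) (A : 'M[R]_(m, p)) : R :=
  sup [set enorm (A *m v) | v in [set v : 'cV[R]_p | enorm v <= 1]].

Definition posdefmx (m : nat) (A : 'M[R]_m) : Prop :=
  A^T = A /\ forall v : 'cV[R]_m, v != 0 -> 0 < (v^T *m A *m v) ord0 ord0.

Definition gtmx (m : nat) (A B : 'M[R]_m) : Prop := posdefmx (A - B).

(* MathComp's eigenvalue only sees eigenvalues in R; the spectra below are
   taken of symmetric matrices, all of whose eigenvalues are real. *)
Definition spectrum (m : nat) (A : 'M[R]_m) : set R :=
  [set a | eigenvalue A a].

Definition min_sigma (m : nat) (A : 'M[R]_m) : R := inf (spectrum A).
Definition max_sigma (m : nat) (A : 'M[R]_m) : R := sup (spectrum A).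

(* Minimum and maximum of f 1, ..., f n; only meant for n >= 1. *)
Definition min1n (n : nat) (f : nat -> R) : R :=
  \big[Num.min/f 1%N]_(1 <= i < n.+1) f i.
Definition max1n (n : nat) (f : nat -> R) : R :=
  \big[Num.max/f 1%N]_(1 <= i < n.+1) f i.

Definition mx3 (rows : seq (seq R)) : 'M[R]_3 :=
  \matrix_(i < 3, j < 3) (nth [::] rows i)`_j.

Definition crossmx (r : 'cV[R]_3) : 'M[R]_3 :=
  let x := r (inord 0) ord0 in
  let y := r (inord 1) ord0 in
  let z := r (inord 2) ord0 in
  mx3 [:: [:: 0; - z; y]; [:: z; 0; - x]; [:: - y; x; 0]].

Definition rotz (a : R) : 'M[R]_3 :=
  mx3 [:: [:: cos a; - sin a; 0]; [:: sin a; cos a; 0]; [:: 0; 0; 1]].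

Definition rotation (Q : 'M[R]_3) : Prop := Q^T *m Q = 1%:M /\ \det Q = 1.

Definition force_mx (Q : 'M[R]_3) (r : 'cV[R]_3) : 'M[R]_(3 + 3) :=
  block_mx Q 0 (crossmx r *m Q) Q.

Definition ztau : 'cV[R]_(3 + 3) := col_mx 0 (delta_mx (inord 2) ord0).

Definition angular (V : 'cV[R]_(3 + 3)) : 'cV[R]_3 := dsubmx V.

End LinearAlgebra.

(* Links and joints carry their usual numbers 1, ..., n (0 is the base), so the
   families below are indexed by nat and only constrained where the index is
   meaningful. Time ranges over t >= 0; signals are total functions on R whose
   values at negative times are irrelevant except that derivatives at t = 0 are
   two-sided (a trajectory smooth on [0, +oo[ can always be so extended). *)

Record manipulator (R : realType) := Manipulator {
  (* pose of {T_i} in {B_i}: constant, the links being rigid *)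
  rot_BT : nat -> 'M[R]_3;
  pos_BT : nat -> 'cV[R]_3;
  (* pose of {B_i} in {T_(i-1)} at zero joint angle, with {T_0} read as {B_0} *)
  rot_TB0 : nat -> 'M[R]_3;
  pos_TB : nat -> 'cV[R]_3;
  massmx : nat -> 'M[R]_(3 + 3);
  coriolis : nat -> {linear 'cV[R]_3 -> 'M[R]_(3 + 3)};
  coriolis_bound : nat -> R;                           (* M_c *)
  inertia : nat -> R;                                  (* I_m *)
  friction : nat -> R -> R;                            (* f_c *)
  friction_lip : nat -> R                              (* m_c *)
}.

Record gains (R : realType) := Gains {
  K_B : nat -> 'M[R]_(3 + 3);
  L_B : nat -> 'M[R]_(3 + 3);
  L_q : nat -> R;                                      (* L_i *)
  ell : nat -> R;
  kq : nat -> R;                                       (* k_i *)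
  lam : nat -> R
}.

(* As functions of i and t. The suffix _B or _T is the frame, Fstar the net
   force/moment, hat an observer quantity, r a required one. *)
Record signals (R : realType) := Signals {
  q : nat -> R -> R;
  tau : nat -> R -> R;
  G_B : nat -> R -> 'cV[R]_(3 + 3);
  P_B : nat -> R -> 'cV[R]_(3 + 3);
  V_B : nat -> R -> 'cV[R]_(3 + 3);
  V_T : nat -> R -> 'cV[R]_(3 + 3);
  Fstar : nat -> R -> 'cV[R]_(3 + 3);
  F_B : nat -> R -> 'cV[R]_(3 + 3);
  F_T : nat -> R -> 'cV[R]_(3 + 3);
  Phat : nat -> R -> 'cV[R]_(3 + 3);
  Z_B : nat -> R -> 'cV[R]_(3 + 3);
  qhat : nat -> R -> R;
  zq : nat -> R -> R;                                  (* z_i *)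
  Vr_B : nat -> R -> 'cV[R]_(3 + 3);
  Vr_T : nat -> R -> 'cV[R]_(3 + 3);
  Frstar : nat -> R -> 'cV[R]_(3 + 3);
  Fr_B : nat -> R -> 'cV[R]_(3 + 3);
  Fr_T : nat -> R -> 'cV[R]_(3 + 3)
}.

Section ClosedLoop.
Variables (R : realType) (n : nat).
Variables (m : manipulator R) (g : gains R) (s : signals R).
Variable qd : nat -> R -> R.

Definition derivable_nonneg (V : normedModType R) (f : R -> V) : Prop :=
  forall t : R, 0 <= t -> derivable f t 1.

(* "Increasing" friction is taken in the weak sense, which covers the strict
   one; friction_lip is a Lipschitz constant, not necessarily the best. *)
Definition manipulator_ok : Prop := forall i : nat, (1 <= i <= n)%N ->
  [/\ rotation (rot_BT m i), rotation (rot_TB0 m i) & posdefmx (massmx m i)] /\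
  [/\ forall w, (coriolis m i w)^T = - coriolis m i w,
      forall w, opnorm (coriolis m i w) <= coriolis_bound m i * enorm w
    & 0 < coriolis_bound m i] /\
  [/\ 0 < inertia m i,
      {homo friction m i : x y / x <= y},
      forall x, friction m i (- x) = - friction m i x
    & (friction_lip m i).-lipschitz (friction m i)].

Definition U_BT (i : nat) : 'M[R]_(3 + 3) := force_mx (rot_BT m i) (pos_BT m i).

(* From {B_i} to {T_(i-1)}. Joint i turns {B_i} by q_i about its own z axis
   and leaves its origin fixed: this is what the relative velocity
   ztau * dq_i of the kinematics means. *)
Definition U_TB (i : nat) (t : R) : 'M[R]_(3 + 3) :=
  force_mx (rot_TB0 m i *m rotz (q s i t)) (pos_TB m i).

(* From {B_i} to {B_(i-1)} *)
Definition U_BB (i : nat) (t : R) : 'M[R]_(3 + 3) :=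
  if (i <= 1)%N then U_TB i t else U_BT i.-1 *m U_TB i t.

Definition dq (i : nat) : R -> R := derive1 (q s i).
Definition dqhat (i : nat) : R -> R := derive1 (qhat s i).
Definition Vhat (i : nat) : R -> 'cV[R]_(3 + 3) := derive1 (Phat s i).
Definition dqr (i : nat) (t : R) : R :=
  derive1 (qd i) t + lam g i * (qd i t - qhat s i t).
Definition tau_a (i : nat) (t : R) : R := ((ztau R)^T *m F_B s i t) ord0 ord0.
Definition tau_ar (i : nat) (t : R) : R := ((ztau R)^T *m Fr_B s i t) ord0 ord0.

Definition smooth_signals : Prop := forall i : nat, (1 <= i <= n)%N ->
  [/\ derivable_nonneg (q s i), derivable_nonneg (dq i),
      derivable_nonneg (P_B s i) & derivable_nonneg (V_B s i)] /\
  [/\ derivable_nonneg (Phat s i), derivable_nonneg (Z_B s i),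
      derivable_nonneg (qhat s i) & derivable_nonneg (zq s i)] /\
  [/\ derivable_nonneg (qd i), derivable_nonneg (dqr i)
    & derivable_nonneg (Vr_B s i)].

Definition kinematics : Prop := forall t : R, 0 <= t ->
  V_B s 0 t = 0 /\
  forall i : nat, (1 <= i <= n)%N ->
  [/\ derive1 (P_B s i) t = V_B s i t,
      V_B s i t = dq i t *: ztau R + (U_BB i t)^T *m V_B s i.-1 t
    & V_T s i t = (U_BT i)^T *m V_B s i t].

Definition force_propagation
    (Fs FB FT : nat -> R -> 'cV[R]_(3 + 3)) : Prop :=
  forall t : R, 0 <= t ->
  [/\ forall i : nat, (1 <= i <= n)%N ->
        FB i t = Fs i t + U_BT i *m FT i t,
      FT n t = 0,
      forall i : nat, (2 <= i <= n)%N -> FT i.-1 t = U_TB i t *m FB i t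
    & FB 0 t = U_BB 1 t *m FB 1 t].

Definition link_dynamics : Prop :=
  (forall (i : nat) (t : R), (1 <= i <= n)%N -> 0 <= t ->
     massmx m i *m derive1 (V_B s i) t
     + coriolis m i (angular (V_B s i t)) *m V_B s i t + G_B s i t
     = Fstar s i t) /\
  force_propagation (Fstar s) (F_B s) (F_T s).

Definition joint_dynamics : Prop :=
  forall (i : nat) (t : R), (1 <= i <= n)%N -> 0 <= t ->
    tau s i t = inertia m i * derive1 (dq i) t + friction m i (dq i t) + tau_a i t.

Definition link_observer : Prop :=
  forall (i : nat) (t : R), (1 <= i <= n)%N -> 0 <= t ->
    derive1 (Phat s i) t
      = Z_B s i t - invmx (massmx m i) *m L_B g i *m (Phat s i t - P_B s i t) /\
    massmx m i *m derive1 (Z_B s i) t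
      = Fstar s i t - coriolis m i (angular (Vhat i t)) *m Vhat i t - G_B s i t.

Definition joint_observer : Prop :=
  forall (i : nat) (t : R), (1 <= i <= n)%N -> 0 <= t ->
    derive1 (qhat s i) t = zq s i t - L_q g i * (qhat s i t - q s i t) /\
    inertia m i * derive1 (zq s i) t
      = tau s i t - tau_a i t - friction m i (dqhat i t)
        - ell g i * (qhat s i t - q s i t).

Definition required_velocities : Prop := forall t : R, 0 <= t ->
  Vr_B s 0 t = 0 /\
  forall i : nat, (1 <= i <= n)%N ->
    Vr_B s i t = dqr i t *: ztau R + (U_BB i t)^T *m Vr_B s i.-1 t /\
    Vr_T s i t = (U_BT i)^T *m Vr_B s i t.

Definition required_forces : Prop :=
  (forall (i : nat) (t : R), (1 <= i <= n)%N -> 0 <= t ->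
     Frstar s i t
     = massmx m i *m derive1 (Vr_B s i) t
       + coriolis m i (angular (Vhat i t)) *m Vr_B s i t + G_B s i t
       + K_B g i *m (Vr_B s i t - Vhat i t)) /\
  force_propagation (Frstar s) (Fr_B s) (Fr_T s).

Definition control_law : Prop :=
  forall (i : nat) (t : R), (1 <= i <= n)%N -> 0 <= t ->
    tau s i t = inertia m i * derive1 (dqr i) t + friction m i (dqr i t)
                + tau_ar i t + kq g i * (dqr i t - dqhat i t).

Definition gains_positive : Prop := forall i : nat, (1 <= i <= n)%N ->
  [/\ posdefmx (K_B g i) & posdefmx (L_B g i)] /\
  [/\ 0 < L_q g i, 0 < ell g i, 0 < kq g i & 0 < lam g i].

Record closed_loop : Prop := ClosedLoop {
  cl_manipulator : manipulator_ok;
  cl_gains : gains_positive;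
  cl_smooth : smooth_signals;
  cl_kinematics : kinematics;
  cl_link : link_dynamics;
  cl_joint : joint_dynamics;
  cl_link_observer : link_observer;
  cl_joint_observer : joint_observer;
  cl_required_velocities : required_velocities;
  cl_required_forces : required_forces;
  cl_control : control_law
}.

Definition serr (i : nat) (t : R) : R :=
  (dqhat i t - dq i t) + ell g i * (qhat s i t - q s i t).

Definition xblock (i : nat) (t : R) : 'cV[R]_((3 + 3) + ((3 + 3) + (1 + (1 + 1)))) :=
  col_mx (Vr_B s i t - V_B s i t)
 (col_mx (Vhat i t - V_B s i t)
 (col_mx (dqr i t - dq i t)%:M
 (col_mx (dqhat i t - dq i t)%:M
         (serr i t)%:M))).

Definition xvec (t : R) :=
  \mxcol_(i < n) (xblock i.+1 t : 'cV[R]_((3 + 3) + ((3 + 3) + (1 + (1 + 1))))).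

Definition velocity_norms (i : nat) : set R :=
  [set enorm (V_B s i t) | t in [set t : R | 0 < t]].

Definition M_v (i : nat) : R := sup (velocity_norms i).

Definition alpha_m : R :=
  min1n n (fun i => Num.min (min_sigma (massmx m i)) (inertia m i)).

Definition alpha_M : R :=
  max1n n (fun i => Num.max (max_sigma (massmx m i))
                            (inertia m i + (ell g i)^-1)).

(* The joint angle enters U_BB i t only through multiplication on the right by
   the orthogonal matrix diag(rotz (q_i t), rotz (q_i t)), so the norm is the
   same at all times and the supremum is just its common value. *)
Definition U_norm (i : nat) : R :=
  sup [set opnorm (U_BB i t) | t in [set t : R | 0 <= t]].

Definition M_U : R := \big[Num.max/1]_(1 <= i < n.+1) U_norm i.

End ClosedLoop.

(* Main.v *)
Require Import Defs.
From HB Require Import structures.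
From mathcomp Require Import all_boot all_order all_algebra.
From mathcomp Require Import all_classical all_reals all_analysis.
From mathcomp Require Import ring lra.
Set Implicit Arguments.
Unset Strict Implicit.
Unset Printing Implicit Defensive.
Import Order.TTheory GRing.Theory Num.Theory.
Import numFieldNormedType.Exports.
Local Open Scope classical_set_scope.
Local Open Scope ring_scope.

(** The proof is a Lyapunov argument followed by a cascade.

    Write e_r = V_r - V and e_o = V^ - V for the two velocity errors of a link,
    and rho = dq_r - dq, eta = dq^ - dq, e = q^ - q, sl = eta + ell e for the
    errors of its joint. Subtracting the dynamics from the control and observer
    laws gives, with a = M_c M_v,

      - for the link ([link_error_dynamics], [link_observer_error_dynamics]): the
        skew-symmetric Coriolis terms do no work, what remains of them is
        C(e_o) V, of norm at most a |e_o|, and the gains K and L dominate it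
        ([link_dissipation]);
      - for the joint: I rho', I eta' and I sl' are made of friction increments,
        of the torque difference tau_ar - tau_a and of gain terms.  Because
        ell = L - 1/I, the observer equation also reads I sl' = - df - sl, with df
        the friction increment, so that monotonicity and the Lipschitz bound of
        the friction make the joint part dissipative too ([joint_dissipation]).

    What is left is the power of the force errors. It equals rho (tau_ar - tau_a)
    plus the power entering from the previous tip minus the power leaving at the
    tip of the link
    ([virtual_power_flow]). The first term cancels the coupling of the joint, and
    the flows telescope along the chain, because the base does not move and no
    force acts at the last tip. Hence

      V = sum_i (e_r^T M e_r + e_o^T M e_o + I rho^2 + I eta^2 + ell e^2 + I sl^2)

    satisfies V' <= - c V ([total_rate_le]) and decays exponentially.

    The tracking error x = q_d - q solves x' = - lambda x + (rho + lambda e): a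
    stable scalar equation whose forcing is bounded by a multiple of sqrt V, so
    x^2 + A V, for a large constant A, also decays exponentially
    ([cascade_exponential_decay]). *)

(** * Euclidean geometry and operator norms *)

Section Euclidean.
Variable R : realType.

Definition dot (m : nat) (u v : 'cV[R]_m) : R := (u^T *m v) ord0 ord0.

Lemma dotE m (u v : 'cV[R]_m) : dot u v = \sum_i u i ord0 * v i ord0.
Proof. by rewrite /dot mxE; apply: eq_bigr => i _; rewrite mxE. Qed.

Lemma dotC m (u v : 'cV[R]_m) : dot u v = dot v u.
Proof. by rewrite !dotE; apply: eq_bigr => i _; rewrite mulrC. Qed.

Lemma dotDr m (u v w : 'cV[R]_m) : dot u (v + w) = dot u v + dot u w.
Proof. by rewrite /dot mulmxDr mxE. Qed.

Lemma dotNr m (u v : 'cV[R]_m) : dot u (- v) = - dot u v.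
Proof. by rewrite /dot mulmxN mxE. Qed.

Lemma dotBr m (u v w : 'cV[R]_m) : dot u (v - w) = dot u v - dot u w.
Proof. by rewrite dotDr dotNr. Qed.

Lemma dotZr m a (u v : 'cV[R]_m) : dot u (a *: v) = a * dot u v.
Proof. by rewrite /dot -scalemxAr mxE. Qed.

Lemma dotDl m (u v w : 'cV[R]_m) : dot (v + w) u = dot v u + dot w u.
Proof. by rewrite dotC dotDr !(dotC u). Qed.

Lemma dotZl m a (u v : 'cV[R]_m) : dot (a *: v) u = a * dot v u.
Proof. by rewrite dotC dotZr dotC. Qed.

Lemma dot0l m (u : 'cV[R]_m) : dot 0 u = 0.
Proof. by rewrite /dot trmx0 mul0mx mxE. Qed.

Lemma dot0r m (u : 'cV[R]_m) : dot u 0 = 0.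
Proof. by rewrite dotC dot0l. Qed.

Lemma dot_trmx m p (A : 'M[R]_(m, p)) (u : 'cV[R]_m) (v : 'cV[R]_p) :
  dot u (A *m v) = dot (A^T *m u) v.
Proof. by rewrite /dot trmx_mul trmxK mulmxA. Qed.

Lemma dot_sqr_ge0 m (u : 'cV[R]_m) : 0 <= dot u u.
Proof. by rewrite dotE sumr_ge0 // => i _; rewrite -expr2 sqr_ge0. Qed.

Lemma enormE m (u : 'cV[R]_m) : enorm u = Num.sqrt (dot u u).
Proof. by rewrite /enorm dotE; under eq_bigr do rewrite expr2. Qed.

Lemma enorm_ge0 m (u : 'cV[R]_m) : 0 <= enorm u.
Proof. exact: sqrtr_ge0. Qed.

Lemma sqr_enorm m (u : 'cV[R]_m) : enorm u ^+ 2 = dot u u.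
Proof. by rewrite enormE sqr_sqrtr // dot_sqr_ge0. Qed.

Lemma enorm_eq0 m (u : 'cV[R]_m) : enorm u = 0 -> u = 0.
Proof.
move=> u0; have /eqP : dot u u = 0 by rewrite -sqr_enorm u0 expr0n.
rewrite dotE psumr_eq0 => [/allP/= h|i _]; last by rewrite -expr2 sqr_ge0.
apply/colP => i; rewrite mxE; apply/eqP.
by have := h i (mem_index_enum i); rewrite /= mulf_eq0 orbb.
Qed.

Lemma enormZ m a (u : 'cV[R]_m) : enorm (a *: u) = `|a| * enorm u.
Proof.
by rewrite !enormE dotZl dotZr mulrA -expr2 sqrtrM ?sqr_ge0 // sqrtr_sqr.
Qed.

Lemma cauchy_schwarz m (u v : 'cV[R]_m) : dot u v <= enorm u * enorm v.
Proof.
have [/enorm_eq0->|u0] := eqVneq (enorm u) 0.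
  by rewrite dot0l mulr_ge0 // enorm_ge0.
have [/enorm_eq0->|v0] := eqVneq (enorm v) 0.
  by rewrite dot0r mulr_ge0 // enorm_ge0.
have uv_gt0 : 0 < enorm u * enorm v by rewrite mulr_gt0 // lt0r enorm_ge0 ?u0 ?v0.
have := dot_sqr_ge0 (enorm v *: u - enorm u *: v).
rewrite dotBr !dotDl -!scaleNr !dotZl !dotZr (dotC v u) -!sqr_enorm.
by move=> h; nra.
Qed.

Lemma dot_ge_enorm m (u v : 'cV[R]_m) : - (enorm u * enorm v) <= dot u v.
Proof.
have := cauchy_schwarz (- u) v; rewrite -scaleN1r dotZl enormZ normrN normr1.
by rewrite mul1r mulN1r lerNl.
Qed.

(** The supremum defining [opnorm] is meaningful: by Cauchy-Schwarz on each row,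
    the Frobenius norm is a bound. *)
Lemma opnorm_has_ubound m p (A : 'M[R]_(m, p)) :
  has_ubound [set enorm (A *m v) | v in [set v : 'cV[R]_p | enorm v <= 1]].
Proof.
pose rows := \col_i enorm (row i A)^T.
exists (enorm rows) => _ [v /= v1 <-].
rewrite /enorm ler_sqrt; last first.
  by rewrite sumr_ge0 // => i _; exact: sqr_ge0.
apply: ler_sum => i _; rewrite [X in _ <= X ^+ 2]mxE.
have -> : (A *m v) i ord0 = dot (row i A)^T v.
  by rewrite dotE mxE; apply: eq_bigr => j _; rewrite !mxE.
have cs1 := cauchy_schwarz (row i A)^T v; have cs2 := dot_ge_enorm (row i A)^T v.
have r0 := enorm_ge0 (row i A)^T; have v0 := enorm_ge0 v.
rewrite -[X in X <= _]real_normK ?num_real // lerXn2r ?nnegrE //.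
rewrite ler_norml; apply/andP; split; nra.
Qed.

Lemma enorm_mulmx_le m p (A : 'M[R]_(m, p)) (v : 'cV[R]_p) :
  enorm (A *m v) <= opnorm A * enorm v.
Proof.
have [/enorm_eq0->|v0] := eqVneq (enorm v) 0.
  by rewrite mulmx0 !enormE !dot0l sqrtr0 mulr0.
have v_gt0 : 0 < enorm v by rewrite lt0r v0 enorm_ge0.
rewrite -ler_pdivrMr //; apply: (ub_le_sup (opnorm_has_ubound A)).
exists ((enorm v)^-1 *: v) => /=.
  by rewrite enormZ gtr0_norm ?invr_gt0 // mulVf.
by rewrite -scalemxAr enormZ gtr0_norm ?invr_gt0 // mulrC.
Qed.

Lemma opnorm_ge0 m p (A : 'M[R]_(m, p)) : 0 <= opnorm A.
Proof.
apply: (ub_le_sup (opnorm_has_ubound A)).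
by exists 0; rewrite /= ?mulmx0 enormE dot0l sqrtr0.
Qed.

Lemma quadratic_form_ub m (A : 'M[R]_m) :
  exists2 b, 0 < b & forall v, dot v (A *m v) <= b * dot v v.
Proof.
exists (opnorm A + 1) => [|v]; first by rewrite ltr_wpDl // opnorm_ge0.
have := cauchy_schwarz v (A *m v); have := enorm_mulmx_le A v.
by rewrite -sqr_enorm; have := enorm_ge0 v => ? ? ?; nra.
Qed.

(** Gyroscopic forces do no work: this is what removes the Coriolis matrix at the
    observed velocity, over which there is no a priori bound. *)
Lemma skew_form_eq0 m (A : 'M[R]_m) (v : 'cV[R]_m) :
  A^T = - A -> dot v (A *m v) = 0.
Proof.
move=> skA; have := dot_trmx A v v.
by rewrite skA mulNmx (dotC _ v) dotNr => h; lra.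
Qed.

Lemma posdefmx_ge0 m (A : 'M[R]_m) (v : 'cV[R]_m) :
  posdefmx A -> 0 <= dot v (A *m v).
Proof.
move=> [_ pA]; have [->|/pA/ltW] := eqVneq v 0; first by rewrite dot0l.
by rewrite /dot mulmxA.
Qed.

(** A row vector killed by [A] would be a nonzero null vector of the form. *)
Lemma posdefmx_unitmx m (A : 'M[R]_m) :
  posdefmx A -> A \in unitmx.
Proof.
move=> [_ pA]; rewrite -row_free_unit -kermx_eq0.
apply/negPn/negP => /rowV0Pn[v /sub_kermxP vA v0].
have := pA v^T; rewrite trmxK vA mul0mx mxE ltxx => /(_ _)/negP; apply => //.
by apply: contra v0 => /eqP/(congr1 trmx); rewrite trmxK trmx0 => ->.
Qed.

Lemma posdefmx_scalar m (a : R) : posdefmx (a%:M : 'M[R]_m.+1) -> 0 < a.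
Proof.
move=> [_ /(_ (delta_mx ord0 ord0))].
rewrite mul_mx_scalar -scalemxAl trmx_delta mul_delta_mx !mxE !eqxx mulr1.
apply; apply/eqP => /colP/(_ ord0); rewrite !mxE !eqxx /= => /eqP.
by rewrite oner_eq0.
Qed.

Lemma enorm_angular (v : 'cV[R]_(3 + 3)) : enorm (angular v) <= enorm v.
Proof.
rewrite !enormE ler_sqrt ?dot_sqr_ge0 // -[in leRHS](vsubmxK v) !dotE.
rewrite big_split_ord /=.
under [X in _ <= X + _]eq_bigr do rewrite col_mxEu.
under [X in _ <= _ + X]eq_bigr do rewrite col_mxEd.
by rewrite lerDr sumr_ge0 // => i _; rewrite -expr2 sqr_ge0.
Qed.

End Euclidean.

(** * Derivatives of quadratic forms and exponential decay *)

Section Calculus.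
Variable R : realType.
Implicit Types t : R.

Lemma is_derive_derive1 (V : normedModType R) (f : R -> V) t :
  derivable f t 1 -> is_derive t 1 f (derive1 f t).
Proof. by move=> df; rewrite derive1E; exact: derivableP. Qed.

(** Reduces vector-valued signals to scalar ones, for which the product rule is
    available. *)
Lemma is_derive_mxP m p (f : R -> 'M[R]_(m, p)) (df : 'M[R]_(m, p)) t :
  is_derive t 1 f df <->
  forall i j, is_derive t 1 (fun x => f x i j) (df i j).
Proof.
split=> [fdf i j|fdf].
  have /derivable_mxP dfij : derivable f t 1 by [].
  by apply: DeriveDef => //; rewrite -(@derive_val _ _ _ _ _ _ _ fdf) derive_mx // mxE.
have fd : derivable f t 1 by apply/derivable_mxP => i j.
apply: DeriveDef => //; rewrite derive_mx //; apply/matrixP => i j.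
by rewrite mxE derive_val.
Qed.

Lemma is_derive_bigsum (I : eqType) (r : seq I) (h : I -> R -> R)
    (dh : I -> R) t :
  (forall i, i \in r -> is_derive t 1 (h i) (dh i)) ->
  is_derive t 1 (fun x => \sum_(i <- r) h i x) (\sum_(i <- r) dh i).
Proof.
elim: r => [_|i r IH hr].
  rewrite big_nil; under eq_fun do rewrite big_nil.
  exact: is_derive_cst.
rewrite big_cons; under eq_fun do rewrite big_cons.
apply: is_deriveD; first by apply: hr; rewrite mem_head.
by apply: IH => j jr; apply: hr; rewrite in_cons jr orbT.
Qed.

Lemma is_derive_mulmx m p (A : 'M[R]_(m, p)) (f : R -> 'cV[R]_p) df t :
  is_derive t 1 f df -> is_derive t 1 (fun x => A *m f x) (A *m df).
Proof.
move/is_derive_mxP => fdf; apply/is_derive_mxP => i j.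
rewrite mxE; under eq_fun do rewrite mxE.
by apply: is_derive_bigsum => k _; apply: is_deriveZ.
Qed.

Lemma is_derive_dot m (f g : R -> 'cV[R]_m) df dg t :
  is_derive t 1 f df -> is_derive t 1 g dg ->
  is_derive t 1 (fun x => dot (f x) (g x)) (dot (f t) dg + dot df (g t)).
Proof.
move=> /is_derive_mxP fdf /is_derive_mxP gdg.
under eq_fun do rewrite dotE.
rewrite !dotE -big_split /=; apply: is_derive_bigsum => i _.
by rewrite (mulrC (df i ord0)); apply: is_deriveM.
Qed.

Lemma is_derive_quadratic_form m (A : 'M[R]_m) (f : R -> 'cV[R]_m) df t :
  A^T = A -> is_derive t 1 f df ->
  is_derive t 1 (fun x => dot (f x) (A *m f x)) (2 * dot (f t) (A *m df)).
Proof.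
move=> AT fdf; apply: (is_derive_eq (is_derive_dot _ (is_derive_mulmx A fdf))).
by rewrite (dot_trmx A df) AT [dot (A *m df) _]dotC; ring.
Qed.

Lemma is_derive_scaled_sqr (a : R) (f : R -> R) df t :
  is_derive t 1 f df ->
  is_derive t 1 (fun x => a * f x ^+ 2) (2 * (f t * (a * df))).
Proof.
move=> fdf; apply: (is_derive_eq (is_deriveZ a (is_deriveX 2 fdf))).
by rewrite /GRing.scale /= expr1; ring.
Qed.

(** [f t * expR (c * t)] is nonincreasing. The differential inequality is asked
    for positive times only, since bounds defined by suprema over [0 < t] say
    nothing at [t = 0]. *)
Lemma exponential_decay (f df : R -> R) (c : R) :
  (forall t, 0 <= t -> is_derive t 1 f (df t)) ->
  (forall t, 0 < t -> df t <= - c * f t) ->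
  forall t, 0 <= t -> f t <= f 0 * expR (- c * t).
Proof.
move=> fdf dfle t t0.
pose h x := f x * expR (c * x).
have hdh (x : R) : 0 <= x -> is_derive x 1 h ((df x + c * f x) * expR (c * x)).
  move=> x0; have fx := fdf x x0.
  have ex : is_derive x 1 (fun x => expR (c * x)) (c * expR (c * x)).
    have cx : is_derive x 1 (fun x => c * x) c.
      by apply: (is_derive_eq (is_deriveZ c (is_derive_id x 1))); exact: mulr1.
    by apply: (is_derive_eq (is_derive1_comp (is_derive_expR _) cx)); rewrite mulrC.
  apply: (is_derive_eq (is_deriveM fx ex)).
  by rewrite /GRing.scale /=; ring.
have : h t <= h 0.
  apply: (@ler0_derive1_nincry _ h 0) => //.
  - by move=> x; rewrite in_itv /= andbT => /ltW/hdh.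
  - move=> x; rewrite in_itv /= andbT => x0.
    have hx := hdh x (ltW x0); rewrite derive1E derive_val.
    by rewrite pmulr_lle0 ?expR_gt0 //; have := dfle x x0; lra.
  - apply: derivable_within_continuous => x; rewrite in_itv /= andbT => x0.
    by have := hdh x x0.
rewrite /h mulr0 expR0 mulr1 => hle.
rewrite mulNr expRN ler_pdivlMr ?expR_gt0 //.
Qed.

(** A stable scalar equation forced by a signal dominated by a decaying [V]. With
    [a] large enough, half of the decay of [a * V] pays for the forcing term in
    the derivative of [e ^+ 2], so that [e ^+ 2 + a * V] decays at the slower of
    the rates [l] and [c / 2]. *)
Lemma cascade_exponential_decay (e w V dV : R -> R) (l b c : R) :
  0 < l -> 0 < b -> 0 < c ->
  (forall t : R, 0 <= t -> is_derive t 1 e (- l * e t + w t)) ->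
  (forall t : R, 0 <= t -> is_derive t 1 V (dV t)) ->
  (forall t : R, 0 < t -> dV t <= - c * V t) ->
  (forall t : R, 0 <= t -> 0 <= V t /\ w t ^+ 2 <= b * V t) ->
  exists C mu : R, [/\ 0 < C, 0 < mu
    & forall t : R, 0 <= t -> `|e t| <= C * expR (- mu * t)].
Proof.
move=> l0 b0 c0 de dVt dVle wle.
pose a := 2 * b / (l * c); pose mu := Num.min l (c / 2).
have a0 : 0 < a by rewrite divr_gt0 ?mulr_gt0.
have mu0 : 0 < mu by rewrite lt_min l0 divr_gt0.
pose W t := 1 * e t ^+ 2 + a * V t.
pose dW t := 2 * (e t * (1 * (- l * e t + w t))) + a * dV t.
have dWt (t : R) : 0 <= t -> is_derive t 1 W (dW t).
  move=> t0; have he := is_derive_scaled_sqr 1 (de t t0).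
  exact: (is_deriveD he (is_deriveZ a (dVt t t0))).
have dWle (t : R) : 0 < t -> dW t <= - mu * W t.
  move=> t0; have [V0 wV] := wle t (ltW t0); have VV := dVle t t0.
  have mul1 : mu <= l by rewrite ge_min lexx.
  have mul2 : mu <= c / 2 by rewrite ge_min lexx orbT.
  have h1 : mu * e t ^+ 2 <= l * e t ^+ 2 by rewrite ler_wpM2r ?sqr_ge0.
  have h2 : mu * (a * V t) <= c / 2 * (a * V t).
    by rewrite ler_wpM2r // mulr_ge0 // ltW.
  have h3 : a * dV t <= a * (- c * V t) by rewrite ler_wpM2l // ltW.
  have h4 : c / 2 * (a * V t) = l^-1 * (b * V t).
    by rewrite /a; field; rewrite !gt_eqF.
  (* Young's inequality, weighted so as to leave half of the damping of e *)
  have h5 : 2 * (e t * w t) <= l * e t ^+ 2 + l^-1 * w t ^+ 2.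
    have : 0 <= l^-1 * (l * e t - w t) ^+ 2.
      by rewrite mulr_ge0 ?sqr_ge0 // invr_ge0 ltW.
    have -> : l^-1 * (l * e t - w t) ^+ 2
      = l * e t ^+ 2 + l^-1 * w t ^+ 2 - 2 * (e t * w t).
      by field; rewrite gt_eqF.
    by rewrite subr_ge0.
  have h6 : l^-1 * w t ^+ 2 <= l^-1 * (b * V t).
    by rewrite ler_wpM2l // invr_ge0 ltW.
  rewrite /dW /W; lra.
have Wle := exponential_decay dWt dWle.
exists (Num.sqrt (W 0) + 1), (mu / 2); split; first by rewrite ltr_wpDl ?sqrtr_ge0.
  by rewrite divr_gt0.
move=> t t0.
have eW : e t ^+ 2 <= W 0 * expR (- mu * t).
  apply: le_trans (Wle t t0); rewrite /W mul1r lerDl mulr_ge0 // ?(ltW a0) //.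
  by have [] := wle t t0.
have W0 : 0 <= W 0.
  by rewrite /W mul1r addr_ge0 ?sqr_ge0 // mulr_ge0 // ?(ltW a0); have [] := wle 0 (lexx _).
rewrite -sqrtr_sqr.
apply: (@le_trans _ _ (Num.sqrt (W 0 * expR (- mu * t)))); first exact: ler_wsqrtr.
have -> : - mu * t = 2%:R * (- (mu / 2) * t) by field.
rewrite expRM_natl sqrtrM // sqrtr_sqr gtr0_norm ?expR_gt0 //.
by rewrite ler_wpM2r ?expR_ge0 // lerDl.
Qed.

(** The least of finitely many rates, for a property that is inherited by smaller
    rates. *)
Lemma common_positive_rate (I : eqType) (r : seq I)
    (P : I -> R -> Prop) :
  (forall i c c', c' <= c -> P i c -> P i c') ->
  (forall i, i \in r -> exists2 c, 0 < c & P i c) ->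
  exists2 c, 0 < c & forall i, i \in r -> P i c.
Proof.
move=> Pmono; elim: r => [_|i r IH hr]; first by exists 1.
have [c c0 Pc] := hr i (mem_head _ _).
have [|d d0 Pd] := IH; first by move=> j jr; apply: hr; rewrite in_cons jr orbT.
exists (Num.min c d) => [|j]; first by rewrite lt_min c0.
rewrite in_cons => /orP[/eqP->|jr]; first by apply: Pmono Pc; rewrite ge_min lexx.
by apply: Pmono (Pd j jr); rewrite ge_min lexx orbT.
Qed.

End Calculus.

(** * Dissipation inequalities of one link and one joint *)

Section Dissipation.
Variable R : realType.

(** Only [C (angular eo) *m V] works against the damping, and its norm is at most
    [a * enorm eo] with [a = Mc * Mv]. With [x = enorm er] and [y = enorm eo], the
    cross terms obey [K x y <= K (x^2 + y^2) / 2] and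
    [x (a y) <= (x^2 + a^2 y^2) / 2]: this is where the lower bound [1] on [K] and
    the bound [a (1 + a / 2) + K / 2] on [L] come from. *)
Lemma link_dissipation (C : {linear 'cV[R]_3 -> 'M[R]_(3 + 3)})
    (Mc Mv K L : R) (w : 'cV[R]_3) (V er eo : 'cV[R]_(3 + 3)) :
  (forall w, (C w)^T = - C w) ->
  (forall w, opnorm (C w) <= Mc * enorm w) -> 0 < Mc -> 0 < K -> enorm V <= Mv ->
  dot er (- (C w *m er) - C (angular eo) *m V - K *: (er - eo))
  + dot eo (- (C w *m eo) - C (angular eo) *m V - L *: eo)
  <= - (2^-1 * (K - 1) * dot er er
        + (L - (Mc * Mv * (1 + 2^-1 * (Mc * Mv)) + 2^-1 * K)) * dot eo eo).
Proof.
move=> Csk Cub Mc0 K0 VMv.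
rewrite !(dotBr, dotNr, dotZr) !(skew_form_eq0 _ (Csk w)) -!sqr_enorm.
set cV := C (angular eo) *m V.
have cVle : enorm cV <= Mc * Mv * enorm eo.
  apply: (le_trans (enorm_mulmx_le _ _)).
  apply: (@le_trans _ _ (Mc * enorm eo * Mv)); last by rewrite mulrAC.
  apply: ler_pM; rewrite ?opnorm_ge0 ?enorm_ge0 //.
  by apply: (le_trans (Cub _)); rewrite ler_pM2l // enorm_angular.
have := cauchy_schwarz er eo.
have := dot_ge_enorm er cV; have := dot_ge_enorm eo cV.
move: cVle (enorm_ge0 er) (enorm_ge0 eo).
set x := enorm er; set y := enorm eo; set z := enorm cV; set a := Mc * Mv.
move=> zle x0 y0 h1 h2 h3.
have h4 : x * z <= x * (a * y) by rewrite ler_wpM2l.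
have h5 : y * z <= y * (a * y) by rewrite ler_wpM2l.
have h6 : K * dot er eo <= K * (x * y) by rewrite ler_pM2l.
have h7 : 0 <= K * (x - y) ^+ 2 by rewrite mulr_ge0 ?sqr_ge0 // ltW.
have h8 : 0 <= (x - a * y) ^+ 2 by rewrite sqr_ge0.
lra.
Qed.

Lemma nondecreasing_incr_ge0 (f : R -> R) (x y : R) :
  {homo f : x y / x <= y} -> 0 <= (x - y) * (f x - f y).
Proof.
move=> fmono; have [yx|xy] := leP y x.
  by rewrite mulr_ge0 // subr_ge0 // fmono.
by rewrite mulr_le0 // subr_le0 ?fmono // ltW.
Qed.

(** Here [r], [v], [o] stand for the required, actual and observed joint velocities,
    [e] for the position error of the observer and [d] for the torque difference.
    The two terms in [l * e * eta] cancel; monotonicity of [f] disposes of the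
    friction increments multiplied by [rho] and [eta]; the one multiplied by [sl]
    is split by Young's inequality and the Lipschitz bound. *)
Lemma joint_dissipation (f : R -> R) (mc I L l k r v o e d rho eta sl : R) :
  {homo f : x y / x <= y} -> mc.-lipschitz f -> 0 <= k ->
  rho = r - v -> eta = o - v -> sl = eta + l * e ->
  rho * (- (f r - f v) - d - k * (rho - eta))
  + eta * (- (f o - f v) - l * e - I * L * eta)
  + e * (l * eta) + sl * (- (f o - f v) - sl)
  <= - (rho * d)
     - (2^-1 * k * rho ^+ 2 + (I * L - 2^-1 * (mc ^+ 2 + k)) * eta ^+ 2
        + 2^-1 * sl ^+ 2).
Proof.
move=> fmono flip k0 rhoE etaE slE.
have h1 : 0 <= rho * (f r - f v) by rewrite rhoE nondecreasing_incr_ge0.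
have h1' : 0 <= eta * (f o - f v) by rewrite etaE nondecreasing_incr_ge0.
have h2 : `|f o - f v| <= mc * `|eta| by rewrite etaE; exact: (flip (o, v)).
have h3 : (f o - f v) ^+ 2 <= mc ^+ 2 * eta ^+ 2.
  rewrite -exprMn -real_normK ?num_real // -[leRHS]real_normK ?num_real //.
  rewrite lerXn2r ?nnegrE // normrM.
  by apply: (le_trans h2); rewrite ler_wpM2r // ler_norm.
have h4 : 0 <= (sl + (f o - f v)) ^+ 2 by rewrite sqr_ge0.
have h5 : 0 <= k * (rho - eta) ^+ 2 by rewrite mulr_ge0 ?sqr_ge0.
have -> : e * (l * eta) = eta * (sl - eta) by rewrite slE; ring.
have -> : l * e = sl - eta by rewrite slE addrC addKr.
lra.
Qed.

End Dissipation.

(** * Error dynamics and virtual power flow *)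

Section ErrorSystem.
Variables (R : realType) (n : nat).
Variables (m : manipulator R) (g : gains R) (s : signals R).
Variable qd : nat -> R -> R.
Hypothesis cl : closed_loop n m g s qd.
Implicit Types (i : nat) (t : R).

(** The right-hand sides of the observer equations. They agree with the observed
    velocities, that is with the derivatives of [Phat] and [qhat], at nonnegative
    times, but unlike these derivatives they are differentiable at [t = 0] too,
    whatever the signals are at negative times. *)
Definition observed_link_velocity i t : 'cV[R]_(3 + 3) :=
  Z_B s i t - invmx (massmx m i) *m L_B g i *m (Phat s i t - P_B s i t).

Definition observed_joint_velocity i t : R :=
  zq s i t - L_q g i * (qhat s i t - q s i t).

Definition link_error i t := Vr_B s i t - V_B s i t.
Definition link_observer_error i t := observed_link_velocity i t - V_B s i t.
Definition joint_error i t := dqr g s qd i t - dq s i t.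
Definition joint_observer_error i t := observed_joint_velocity i t - dq s i t.
Definition position_observer_error i t := qhat s i t - q s i t.
Definition sliding_error i t :=
  joint_observer_error i t + ell g i * position_observer_error i t.

(** Twice the energy of the errors of link and joint [i]. The two squares involving
    the joint observer velocity, with the elastic term [ell * e ^+ 2], use both
    forms of the joint observer equation: the original one and the one in the
    sliding variable. *)
Definition lyapunov i t : R :=
  dot (link_error i t) (massmx m i *m link_error i t)
  + dot (link_observer_error i t) (massmx m i *m link_observer_error i t)
  + inertia m i * joint_error i t ^+ 2
  + inertia m i * joint_observer_error i t ^+ 2
  + ell g i * position_observer_error i t ^+ 2
  + inertia m i * sliding_error i t ^+ 2.

(** The [d_] quantities are the derivatives of the errors, and [link_rate] and
    [joint_rate] gather half of the derivative of [lyapunov]. *)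
Definition d_link_error i t := derive1 (Vr_B s i) t - derive1 (V_B s i) t.
Definition d_link_observer_error i t :=
  derive1 (Z_B s i) t
  - invmx (massmx m i) *m L_B g i *m (derive1 (Phat s i) t - derive1 (P_B s i) t)
  - derive1 (V_B s i) t.
Definition d_joint_error i t := derive1 (dqr g s qd i) t - derive1 (dq s i) t.
Definition d_position_observer_error i t :=
  derive1 (qhat s i) t - derive1 (q s i) t.
Definition d_joint_observer_error i t :=
  derive1 (zq s i) t - L_q g i * d_position_observer_error i t
  - derive1 (dq s i) t.
Definition d_sliding_error i t :=
  d_joint_observer_error i t + ell g i * d_position_observer_error i t.

Definition link_rate i t : R :=
  dot (link_error i t) (massmx m i *m d_link_error i t)
  + dot (link_observer_error i t) (massmx m i *m d_link_observer_error i t).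

Definition joint_rate i t : R :=
  joint_error i t * (inertia m i * d_joint_error i t)
  + joint_observer_error i t * (inertia m i * d_joint_observer_error i t)
  + position_observer_error i t * (ell g i * d_position_observer_error i t)
  + sliding_error i t * (inertia m i * d_sliding_error i t).

Lemma is_derive_lyapunov i t : (1 <= i <= n)%N -> 0 <= t ->
  is_derive t 1 (lyapunov i) (2 * (link_rate i t + joint_rate i t)).
Proof.
move=> i1n t0; have [[_ _ [MT _]] _] := cl_manipulator cl i1n.
have [[]] := cl_smooth cl i1n.
move=> /(_ t t0)/is_derive_derive1 dq0 /(_ t t0)/is_derive_derive1 dq1.
move=> /(_ t t0)/is_derive_derive1 dP /(_ t t0)/is_derive_derive1 dV [[]].
move=> /(_ t t0)/is_derive_derive1 dPh /(_ t t0)/is_derive_derive1 dZ.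
move=> /(_ t t0)/is_derive_derive1 dqh /(_ t t0)/is_derive_derive1 dz [].
move=> _ /(_ t t0)/is_derive_derive1 dr /(_ t t0)/is_derive_derive1 dVr.
have der : is_derive t 1 (link_error i) (d_link_error i t).
  exact: (is_deriveB dVr dV).
have dobs : is_derive t 1 (link_observer_error i) (d_link_observer_error i t).
  exact: (is_deriveB (is_deriveB dZ (is_derive_mulmx _ (is_deriveB dPh dP))) dV).
have drho : is_derive t 1 (joint_error i) (d_joint_error i t).
  exact: (is_deriveB dr dq1).
have dpos : is_derive t 1 (position_observer_error i)
    (d_position_observer_error i t) by exact: (is_deriveB dqh dq0).
have deta : is_derive t 1 (joint_observer_error i) (d_joint_observer_error i t).
  exact: (is_deriveB (is_deriveB dz (is_deriveZ _ dpos)) dq1).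
have dsl : is_derive t 1 (sliding_error i) (d_sliding_error i t).
  exact: (is_deriveD deta (is_deriveZ _ dpos)).
have -> : 2 * (link_rate i t + joint_rate i t) =
  2 * dot (link_error i t) (massmx m i *m d_link_error i t)
  + 2 * dot (link_observer_error i t) (massmx m i *m d_link_observer_error i t)
  + 2 * (joint_error i t * (inertia m i * d_joint_error i t))
  + 2 * (joint_observer_error i t * (inertia m i * d_joint_observer_error i t))
  + 2 * (position_observer_error i t * (ell g i * d_position_observer_error i t))
  + 2 * (sliding_error i t * (inertia m i * d_sliding_error i t)).
  by rewrite /link_rate /joint_rate; ring.
do 4?[apply: is_deriveD; last exact: is_derive_scaled_sqr].
by apply: is_deriveD; exact: is_derive_quadratic_form.
Qed.

Lemma Vhat_observed i t : (1 <= i <= n)%N -> 0 <= t ->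
  Vhat s i t = observed_link_velocity i t.
Proof. by move=> i1n t0; have [] := cl_link_observer cl i1n t0. Qed.

Lemma dqhat_observed i t : (1 <= i <= n)%N -> 0 <= t ->
  dqhat s i t = observed_joint_velocity i t.
Proof. by move=> i1n t0; have [] := cl_joint_observer cl i1n t0. Qed.

Lemma d_position_observer_errorE i t : (1 <= i <= n)%N -> 0 <= t ->
  d_position_observer_error i t = joint_observer_error i t.
Proof.
by move=> i1n t0; rewrite /joint_observer_error -dqhat_observed.
Qed.

(** The power transmitted through the tip of link [i] by the velocity and force
    errors; the base is at rest and transmits none. *)
Definition tip_power i t : R :=
  if i is 0%N then 0
  else dot ((U_BT m i)^T *m link_error i t) (Fr_T s i t - F_T s i t).

(** The matrices that propagate forces towards the base are the transposes of those
    that propagate velocities towards the tip, so the power of the net force error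
    of link [i] is what enters through its joint and the previous tip, minus what
    leaves through its own tip. *)
Lemma virtual_power_flow i t : (1 <= i <= n)%N -> 0 <= t ->
  dot (link_error i t) (Frstar s i t - Fstar s i t)
  = joint_error i t * (tau_ar s i t - tau_a s i t)
    + tip_power i.-1 t - tip_power i t.
Proof.
move=> i1n t0.
have [FB _ FT _] := (cl_link cl).2 t t0.
have [FrB _ FrT _] := (cl_required_forces cl).2 t t0.
have [V0 kin] := cl_kinematics cl t0.
have [Vr0 rkin] := cl_required_velocities cl t0.
have -> : Frstar s i t - Fstar s i t
    = (Fr_B s i t - F_B s i t) - U_BT m i *m (Fr_T s i t - F_T s i t).
  by rewrite FB // FrB // mulmxBr; apply/colP => k; rewrite !mxE; ring.
have -> : tip_power i t
    = dot (link_error i t) (U_BT m i *m (Fr_T s i t - F_T s i t)).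
  by case: i i1n => // i _; rewrite /tip_power dot_trmx.
rewrite dotBr; congr (_ - _).
have -> : link_error i t
    = joint_error i t *: ztau R + (U_BB m s i t)^T *m link_error i.-1 t.
  have [_ + _] := kin i i1n; have [+ _] := rkin i i1n.
  rewrite {1}/link_error => -> ->.
  by rewrite /joint_error scalerBl mulmxBr opprD addrACA.
rewrite dotDl dotZl; congr (_ + _).
  by rewrite dotBr.
rewrite -[LHS]/(dot _ _) -{1}dot_trmx.
(* the base is not the tip of a link: its velocity error vanishes *)
case: i i1n => [//|[|i]] i1n.
  by rewrite /= /link_error Vr0 V0 subrr dot0l.
rewrite /tip_power /U_BB /= -mulmxA dot_trmx; congr dot.
by rewrite mulmxBr -(FrT i.+2) // -(FT i.+2).
Qed.

Lemma tip_power_end t : (0 < n)%N -> 0 <= t -> tip_power n t = 0.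
Proof.
move=> n0 t0; have [_ FT _ _] := (cl_link cl).2 t t0.
have [_ FrT _ _] := (cl_required_forces cl).2 t t0.
by rewrite /tip_power FT FrT subrr dot0r; case: (n).
Qed.

(** Isolates a term that is skew-symmetric in the velocity error and a term that
    involves the bounded actual velocity only through [v]. *)
Lemma coriolis_split i (w0 w1 : 'cV[R]_3) (u v : 'cV[R]_(3 + 3)) :
  coriolis m i w0 *m u - coriolis m i w1 *m v
  = coriolis m i w0 *m (u - v) + coriolis m i (w0 - w1) *m v.
Proof.
by rewrite [coriolis m i (w0 - w1)]linearB /= mulmxBl mulmxBr addrA subrK.
Qed.

Lemma link_error_dynamics i t (K : R) : (1 <= i <= n)%N -> 0 <= t ->
  K_B g i = K%:M ->
  massmx m i *m d_link_error i t
  = (Frstar s i t - Fstar s i t)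
    + (- (coriolis m i (angular (observed_link_velocity i t))
            *m link_error i t)
       - coriolis m i (angular (link_observer_error i t)) *m V_B s i t
       - K *: (link_error i t - link_observer_error i t)).
Proof.
move=> i1n t0 KE.
rewrite (cl_required_forces cl).1 // -(cl_link cl).1 // KE mul_scalar_mx.
rewrite Vhat_observed // /d_link_error mulmxBr.
have -> : link_error i t - link_observer_error i t
    = Vr_B s i t - observed_link_velocity i t.
  by rewrite /link_error /link_observer_error opprB addrA subrK.
have := coriolis_split i (angular (observed_link_velocity i t))
  (angular (V_B s i t)) (Vr_B s i t) (V_B s i t).
rewrite -[angular _ - angular _]linearB /= -/(angular _) -/(link_error i t).
rewrite -/(link_observer_error i t).
move=> /eqP; rewrite subr_eq => /eqP ->.
by apply/colP => k; rewrite !mxE; ring.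
Qed.

Lemma link_observer_error_dynamics i t (L : R) : (1 <= i <= n)%N -> 0 <= t ->
  L_B g i = L%:M ->
  massmx m i *m d_link_observer_error i t
  = - (coriolis m i (angular (observed_link_velocity i t))
         *m link_observer_error i t)
    - coriolis m i (angular (link_observer_error i t)) *m V_B s i t
    - L *: link_observer_error i t.
Proof.
move=> i1n t0 LE; have [[_ _ Mpos] _] := cl_manipulator cl i1n.
have [_ obs] := cl_link_observer cl i1n t0.
have [_ /(_ i i1n)[dP _ _]] := cl_kinematics cl t0.
have dPerr : derive1 (Phat s i) t - derive1 (P_B s i) t
    = link_observer_error i t.
  by rewrite dP -[derive1 (Phat s i) t]/(Vhat s i t) Vhat_observed.
rewrite /d_link_observer_error dPerr 2!mulmxBr obs -(cl_link cl).1 //.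
rewrite -mulmxA mulKVmx ?posdefmx_unitmx // LE mul_scalar_mx Vhat_observed //.
have := coriolis_split i (angular (observed_link_velocity i t))
  (angular (V_B s i t)) (observed_link_velocity i t) (V_B s i t).
rewrite -[angular _ - angular _]linearB /= -/(angular _).
rewrite -/(link_observer_error i t).
move=> /eqP; rewrite subr_eq => /eqP ->.
by apply/colP => k; rewrite !mxE; ring.
Qed.

End ErrorSystem.

(** * Decay rate of the Lyapunov function *)

Section ClosedLoopDecay.
Variables (R : realType) (n : nat).
Variables (m : manipulator R) (g : gains R) (s : signals R).
Variable qd : nat -> R -> R.
Hypothesis cl : closed_loop n m g s qd.
Implicit Types (i : nat) (t : R).

(** The choice [ell = L - 1 / I] turns the observer equation
    [I eta' = - df - ell e - I L eta] into [I sl' = - df - sl]. *)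
Lemma joint_rate_le i t : (1 <= i <= n)%N -> 0 <= t ->
  ell g i = L_q g i - (inertia m i)^-1 ->
  joint_rate m g s qd i t
  <= - (joint_error g s qd i t * (tau_ar s i t - tau_a s i t))
     - (2^-1 * kq g i * joint_error g s qd i t ^+ 2
        + (inertia m i * L_q g i - 2^-1 * (friction_lip m i ^+ 2 + kq g i))
          * joint_observer_error g s i t ^+ 2
        + 2^-1 * sliding_error g s i t ^+ 2).
Proof.
move=> i1n t0 ellE; have [_ [_ [I0 fmono _ flip]]] := cl_manipulator cl i1n.
have [_ [_ _ k0 _]] := cl_gains cl i1n.
have jd := cl_joint cl i1n t0; have ct := cl_control cl i1n t0.
have [_ obs] := cl_joint_observer cl i1n t0.
have dpos := d_position_observer_errorE cl i1n t0.
rewrite (dqhat_observed cl i1n t0) in ct obs.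
have IV : inertia m i * (inertia m i)^-1 = 1 by rewrite mulfV // gt_eqF.
have := @joint_dissipation R (friction m i) (friction_lip m i) (inertia m i)
  (L_q g i) (ell g i) (kq g i) (dqr g s qd i t) (dq s i t)
  (observed_joint_velocity g s i t) (position_observer_error s i t)
  (tau_ar s i t - tau_a s i t) (joint_error g s qd i t)
  (joint_observer_error g s i t) (sliding_error g s i t)
  fmono flip (ltW k0) erefl erefl erefl.
apply: le_trans; rewrite le_eqVlt; apply/orP; left; apply/eqP.
rewrite /joint_rate /d_sliding_error dpos.
have -> : inertia m i * d_joint_error g s qd i t
    = - (friction m i (dqr g s qd i t) - friction m i (dq s i t))
      - (tau_ar s i t - tau_a s i t)
      - kq g i * (joint_error g s qd i t - joint_observer_error g s i t).
  rewrite /d_joint_error /joint_error /joint_observer_error; lra.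
have etaE : inertia m i * d_joint_observer_error g s i t
    = - (friction m i (observed_joint_velocity g s i t)
         - friction m i (dq s i t))
      - ell g i * position_observer_error s i t
      - inertia m i * L_q g i * joint_observer_error g s i t.
  rewrite /d_joint_observer_error dpos /position_observer_error !mulrBr obs jd.
  ring.
have -> : inertia m i * (d_joint_observer_error g s i t
                         + ell g i * joint_observer_error g s i t)
    = - (friction m i (observed_joint_velocity g s i t)
         - friction m i (dq s i t)) - sliding_error g s i t.
  have IellE : inertia m i * ell g i = inertia m i * L_q g i - 1.
    by rewrite ellE mulrBr IV.
  by rewrite mulrDr etaE mulrA IellE /sliding_error; ring.
by rewrite etaE.
Qed.

Lemma link_rate_le i t (K L : R) : (1 <= i <= n)%N -> 0 < t -> 0 < K ->
  K_B g i = K%:M -> L_B g i = L%:M -> has_ubound (velocity_norms s i) ->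
  link_rate m g s i t
  <= joint_error g s qd i t * (tau_ar s i t - tau_a s i t)
     + (tip_power m s i.-1 t - tip_power m s i t)
     - (2^-1 * (K - 1) * dot (link_error s i t) (link_error s i t)
        + (L - (coriolis_bound m i * M_v s i
                  * (1 + 2^-1 * (coriolis_bound m i * M_v s i)) + 2^-1 * K))
          * dot (link_observer_error m g s i t)
                (link_observer_error m g s i t)).
Proof.
move=> i1n t0 K0 KE LE Vub; have [_ [[Csk Cub C0] _]] := cl_manipulator cl i1n.
have VMv : enorm (V_B s i t) <= M_v s i by apply: (ub_le_sup Vub); exists t.
rewrite /link_rate (link_error_dynamics cl i1n (ltW t0) KE).
rewrite (link_observer_error_dynamics cl i1n (ltW t0) LE).
rewrite dotDr (virtual_power_flow cl i1n (ltW t0)) -!addrA.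
rewrite !lerD2l !addrA.
exact: link_dissipation.
Qed.

Lemma lyapunov_ge0 i t : (1 <= i <= n)%N -> 0 <= t ->
  [/\ 0 <= lyapunov m g s qd i t
    & inertia m i * joint_error g s qd i t ^+ 2
      + ell g i * position_observer_error s i t ^+ 2
      <= lyapunov m g s qd i t].
Proof.
move=> i1n t0; have [[_ _ Mpos] [_ [I0 _ _ _]]] := cl_manipulator cl i1n.
have [_ [_ l0 _ _]] := cl_gains cl i1n.
have h1 := posdefmx_ge0 (link_error s i t) Mpos.
have h2 := posdefmx_ge0 (link_observer_error m g s i t) Mpos.
have sqr_pos (a x : R) : 0 < a -> 0 <= a * x ^+ 2.
  by move=> a0; rewrite mulr_ge0 ?sqr_ge0 // ltW.
have h3 := sqr_pos _ (joint_error g s qd i t) I0.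
have h4 := sqr_pos _ (joint_observer_error g s i t) I0.
have h5 := sqr_pos _ (position_observer_error s i t) l0.
have h6 := sqr_pos _ (sliding_error g s i t) I0.
by split; rewrite /lyapunov; lra.
Qed.

(** The squared Euclidean norm of the block of index [i] of the error vector. *)
Definition sqr_error i t : R :=
  dot (link_error s i t) (link_error s i t)
  + dot (link_observer_error m g s i t) (link_observer_error m g s i t)
  + joint_error g s qd i t ^+ 2 + joint_observer_error g s i t ^+ 2
  + sliding_error g s i t ^+ 2.

(** The position error is not among the squares on the right, but
    [ell * e = sl - eta], whence [ell * e ^+ 2 <= 2 * (sl ^+ 2 + eta ^+ 2) / ell]. *)
Lemma lyapunov_le_sqr_error i : (1 <= i <= n)%N ->
  exists2 B, 0 < B & forall t, lyapunov m g s qd i t <= B * sqr_error i t.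
Proof.
move=> i1n; have [_ [_ [I0 _ _ _]]] := cl_manipulator cl i1n.
have [_ [_ l0 _ _]] := cl_gains cl i1n.
have lV0 : 0 < (ell g i)^-1 by rewrite invr_gt0.
have [b b0 bub] := quadratic_form_ub (massmx m i).
exists (b + inertia m i + 2 * (ell g i)^-1) => [|t]; first by lra.
have -> : lyapunov m g s qd i t =
    dot (link_error s i t) (massmx m i *m link_error s i t)
    + dot (link_observer_error m g s i t)
          (massmx m i *m link_observer_error m g s i t)
    + inertia m i * (joint_error g s qd i t ^+ 2
        + joint_observer_error g s i t ^+ 2 + sliding_error g s i t ^+ 2)
    + (ell g i)^-1
        * (sliding_error g s i t - joint_observer_error g s i t) ^+ 2.
  by rewrite /lyapunov /sliding_error; field; rewrite gt_eqF.
rewrite /sqr_error.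
have := bub (link_error s i t); have := bub (link_observer_error m g s i t).
have := dot_sqr_ge0 (link_error s i t).
have := dot_sqr_ge0 (link_observer_error m g s i t).
set er := dot (link_error s i t) (link_error s i t).
set eo := dot (link_observer_error m g s i t) (link_observer_error m g s i t).
set rho := joint_error g s qd i t; set eta := joint_observer_error g s i t.
set sl := sliding_error g s i t => eo0 er0 Meo Mer.
have r0 := sqr_ge0 rho; have e0 := sqr_ge0 eta; have s0 := sqr_ge0 sl.
have k1 : (ell g i)^-1 * (sl - eta) ^+ 2
    <= (ell g i)^-1 * (2 * (sl ^+ 2 + eta ^+ 2)).
  by rewrite ler_wpM2l ?(ltW lV0) //; have := sqr_ge0 (sl + eta); lra.
have k2 : 0 <= b * (rho ^+ 2 + eta ^+ 2 + sl ^+ 2).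
  by rewrite mulr_ge0 ?(ltW b0) // !addr_ge0.
have k3 : 0 <= inertia m i * (er + eo) by rewrite mulr_ge0 ?(ltW I0) // addr_ge0.
have k4 : 0 <= (ell g i)^-1 * (er + eo + rho ^+ 2).
  by rewrite mulr_ge0 ?(ltW lV0) // !addr_ge0.
lra.
Qed.

Lemma lyapunov_rate i (K L : R) : (1 <= i <= n)%N ->
  K_B g i = K%:M -> L_B g i = L%:M -> has_ubound (velocity_norms s i) ->
  1 < K ->
  coriolis_bound m i * M_v s i
    * (1 + 2^-1 * (coriolis_bound m i * M_v s i)) + 2^-1 * K < L ->
  friction_lip m i ^+ 2 + kq g i < 2 * inertia m i * L_q g i ->
  ell g i = L_q g i - (inertia m i)^-1 ->
  exists2 c, 0 < c & forall t, 0 < t ->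
    2 * (link_rate m g s i t + joint_rate m g s qd i t)
    <= 2 * (tip_power m s i.-1 t - tip_power m s i t)
       - c * lyapunov m g s qd i t.
Proof.
move=> i1n KE LE Vub K1 L1 q1 ellE.
have [_ [_ _ k0 _]] := cl_gains cl i1n.
have [B B0 VB] := lyapunov_le_sqr_error i1n.
(* the damping coefficients of the five squares; the gain conditions say that
   they are positive *)
pose x1 := 2^-1 * (K - 1).
pose x2 := L - (coriolis_bound m i * M_v s i
    * (1 + 2^-1 * (coriolis_bound m i * M_v s i)) + 2^-1 * K).
pose x3 := 2^-1 * kq g i.
pose x4 := inertia m i * L_q g i - 2^-1 * (friction_lip m i ^+ 2 + kq g i).
have p1 : 0 < x1 by rewrite /x1; lra.
have p2 : 0 < x2 by rewrite subr_gt0.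
have p3 : 0 < x3 by rewrite /x3; lra.
have p4 : 0 < x4 by rewrite /x4; lra.
pose d := Num.min x1 (Num.min x2 (Num.min x3 (Num.min x4 2^-1))).
have d0 : 0 < d by rewrite /d !lt_min p1 p2 p3 p4 invr_gt0 ltr0n.
exists (2 * (d / B)) => [|t t0]; first by rewrite mulr_gt0 ?divr_gt0.
have := link_rate_le i1n t0 (lt_trans ltr01 K1) KE LE Vub.
have := joint_rate_le i1n (ltW t0) ellE.
rewrite -/x1 -/x2 -/x3 -/x4 => JR LR.
have dV : d / B * lyapunov m g s qd i t <= d * sqr_error i t.
  by rewrite mulrAC ler_pdivrMr // -mulrA ler_pM2l // mulrC.
have [d1 d2 d3 d4 d5] : [/\ d <= x1, d <= x2, d <= x3, d <= x4 & d <= 2^-1].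
  by split; rewrite /d !ge_min lexx ?orbT.
have g1 := ler_wpM2r (dot_sqr_ge0 (link_error s i t)) d1.
have g2 := ler_wpM2r (dot_sqr_ge0 (link_observer_error m g s i t)) d2.
have g3 := ler_wpM2r (sqr_ge0 (joint_error g s qd i t)) d3.
have g4 := ler_wpM2r (sqr_ge0 (joint_observer_error g s i t)) d4.
have g5 := ler_wpM2r (sqr_ge0 (sliding_error g s i t)) d5.
move: dV JR LR g1 g2 g3 g4 g5; rewrite /sqr_error.
clearbody d x1 x2 x3 x4; lra.
Qed.

End ClosedLoopDecay.

(** * The whole chain and the tracking error *)

Section TrackingDecay.
Variables (R : realType) (n : nat).
Variables (m : manipulator R) (g : gains R) (s : signals R).
Variable qd : nat -> R -> R.
Hypothesis n1 : (0 < n)%N.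
Hypothesis cl : closed_loop n m g s qd.
Implicit Types (i : nat) (t : R).

Definition total_lyapunov t : R :=
  \sum_(1 <= i < n.+1) lyapunov m g s qd i t.

Definition total_rate t : R :=
  \sum_(1 <= i < n.+1) 2 * (link_rate m g s i t + joint_rate m g s qd i t).

Lemma is_derive_total_lyapunov t : 0 <= t ->
  is_derive t 1 total_lyapunov (total_rate t).
Proof.
move=> t0; apply: is_derive_bigsum => i.
rewrite mem_index_iota ltnS => i1n; exact: (is_derive_lyapunov cl).
Qed.

Lemma lyapunov_le_total i t : (1 <= i <= n)%N -> 0 <= t ->
  lyapunov m g s qd i t <= total_lyapunov t.
Proof.
move=> i1n t0.
rewrite /total_lyapunov (big_rem i) /=; last by rewrite mem_index_iota ltnS.
rewrite lerDl big_seq sumr_ge0 // => j /mem_rem.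
by rewrite mem_index_iota ltnS => j1n; have [] := lyapunov_ge0 cl j1n t0.
Qed.

(** The flows telescope, and vanish at both ends of the chain. *)
Lemma total_tip_power t : 0 <= t ->
  \sum_(1 <= i < n.+1) (tip_power m s i.-1 t - tip_power m s i t) = 0.
Proof.
move=> t0; rewrite big_add1 /=.
under eq_bigr do rewrite -opprB.
by rewrite sumrN telescope_sumr // (tip_power_end cl n1 t0) subr0 oppr0.
Qed.

Lemma total_rate_le (c : R) :
  (forall i t, (1 <= i <= n)%N -> 0 < t ->
     2 * (link_rate m g s i t + joint_rate m g s qd i t)
     <= 2 * (tip_power m s i.-1 t - tip_power m s i t)
        - c * lyapunov m g s qd i t) ->
  forall t, 0 < t -> total_rate t <= - c * total_lyapunov t.
Proof.
move=> rate t t0.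
have -> : - c * total_lyapunov t = \sum_(1 <= i < n.+1)
    (2 * (tip_power m s i.-1 t - tip_power m s i t)
     - c * lyapunov m g s qd i t).
  by rewrite sumrB -!mulr_sumr total_tip_power ?ltW // mulr0 sub0r mulNr.
apply: ler_sum_nat => i; rewrite ltnS => i1n; exact: rate.
Qed.

(** The required velocity is built from the observed position, hence the forcing by
    the observer error besides the velocity error. *)
Lemma is_derive_tracking_error i t : (1 <= i <= n)%N -> 0 <= t ->
  is_derive t 1 (fun t => qd i t - q s i t)
    (- lam g i * (qd i t - q s i t)
     + (joint_error g s qd i t + lam g i * position_observer_error s i t)).
Proof.
move=> i1n t0; have [[/(_ t t0)/is_derive_derive1 dqt _ _ _] [_]] := cl_smooth cl i1n.
move=> [/(_ t t0)/is_derive_derive1 dqdt _ _].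
apply: (is_derive_eq (is_deriveB dqdt dqt)).
by rewrite /joint_error /dqr /position_observer_error /dq; ring.
Qed.

Lemma tracking_forcing_le i : (1 <= i <= n)%N ->
  exists2 b, 0 < b & forall t, 0 <= t ->
    (joint_error g s qd i t + lam g i * position_observer_error s i t) ^+ 2
    <= b * total_lyapunov t.
Proof.
move=> i1n; have [_ [_ [I0 _ _ _]]] := cl_manipulator cl i1n.
have [_ [_ l0 _ lam0]] := cl_gains cl i1n.
pose b1 := 2 / inertia m i; pose b2 := 2 * lam g i ^+ 2 / ell g i.
have b10 : 0 < b1 by rewrite divr_gt0.
have b20 : 0 < b2 by rewrite divr_gt0 // mulr_gt0 // exprn_gt0.
exists (b1 + b2) => [|t t0]; first by rewrite addr_gt0.
have [_ lower] := lyapunov_ge0 cl i1n t0.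
apply: le_trans (_ : (b1 + b2) * lyapunov m g s qd i t <= _); last first.
  by rewrite ler_pM2l ?addr_gt0 // lyapunov_le_total.
apply: le_trans (ler_wpM2l (ltW (addr_gt0 b10 b20)) lower).
set rho := joint_error g s qd i t; set e := position_observer_error s i t.
have h1 : b1 * (inertia m i * rho ^+ 2) = 2 * rho ^+ 2.
  by rewrite /b1; field; rewrite gt_eqF.
have h2 : b2 * (ell g i * e ^+ 2) = 2 * (lam g i * e) ^+ 2.
  by rewrite /b2; field; rewrite gt_eqF.
have h3 : 0 <= b1 * (ell g i * e ^+ 2).
  by rewrite mulr_ge0 ?(ltW b10) // mulr_ge0 ?sqr_ge0 // ltW.
have h4 : 0 <= b2 * (inertia m i * rho ^+ 2).
  by rewrite mulr_ge0 ?(ltW b20) // mulr_ge0 ?sqr_ge0 // ltW.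
have := sqr_ge0 (rho - lam g i * e); lra.
Qed.

End TrackingDecay.

Theorem theorem6p3 (R : realType) (n : nat) (hn : (1 <= n)%N)
  (m : manipulator R) (g : gains R) (s : signals R) (qd : nat -> R -> R)
  (hcl : closed_loop n m g s qd)
  (KB LB Md Md' : nat -> R)
  (hKLpos : forall i : nat, (1 <= i <= n)%N -> 0 < KB i /\ 0 < LB i)
  (hKL : forall i : nat, (1 <= i <= n)%N ->
     K_B g i = (KB i)%:M /\ L_B g i = (LB i)%:M)
  (hMd : forall i : nat, (1 <= i <= n)%N -> 0 < Md i /\ 0 < Md' i)
  (hqd : forall (i : nat) (t : R), (1 <= i <= n)%N -> 0 <= t ->
     `|qd i t| <= Md i /\ `|derive1 (qd i) t| <= Md' i)
  (hMv : forall i : nat, (1 <= i <= n)%N -> has_ubound (velocity_norms s i))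
  (hgainK : forall i : nat, (1 <= i <= n)%N -> gtmx (K_B g i) 1%:M)
  (hgainL : forall i : nat, (1 <= i <= n)%N ->
     gtmx (L_B g i)
       ((coriolis_bound m i * M_v s i
          * (1 + 2^-1 * (coriolis_bound m i * M_v s i)))%:M
        + 2^-1 *: K_B g i))
  (hgainq : forall i : nat, (1 <= i <= n)%N ->
     [/\ 0 < kq g i,
         Num.max 2 (friction_lip m i ^+ 2 + kq g i) < 2 * inertia m i * L_q g i,
         ell g i = L_q g i - (inertia m i)^-1,
         0 < ell g i
       & 0 < lam g i])
  (hlam : forall i : nat, (1 <= i <= n)%N -> (alpha_M n m g)^-1 < 4 * lam g i)
  (hq0 : forall i : nat, (1 <= i <= n)%N -> qhat s i 0 = qd i 0)
  (hx0 : enorm (xvec n g s qd 0) <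
     min1n n (fun i =>
       Num.sqrt (alpha_m n m / alpha_M n m g) *
       (((Num.sqrt (1 + 2 * LB i - KB i) - 1) / coriolis_bound m i
           - \sum_(1 <= k < i.+1) M_U n m s ^+ k * Md' k)
        / (1 + \sum_(1 <= k < i.+1)
                 M_U n m s ^+ k
                 * (16 * lam g k / (4 * lam g k - (alpha_M n m g)^-1)))))) :
  forall i : nat, (1 <= i <= n)%N ->
    exists C mu : R, [/\ 0 < C, 0 < mu
      & forall t : R, 0 <= t -> `|qd i t - q s i t| <= C * expR (- mu * t)].
Proof.
move=> i i1n.
have [c c0 rate] : exists2 c, 0 < c & forall j, j \in index_iota 1 n.+1 ->
    forall t : R, 0 < t ->
    2 * (link_rate m g s j t + joint_rate m g s qd j t)
    <= 2 * (tip_power m s j.-1 t - tip_power m s j t)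
       - c * lyapunov m g s qd j t /\ 0 <= lyapunov m g s qd j t.
  apply: common_positive_rate => [j c c' c'c P t t0|j].
    have [h1 h2] := P t t0; split=> //; apply: (le_trans h1).
    by rewrite lerD2l lerN2 ler_wpM2r.
  rewrite mem_index_iota ltnS => j1n; have [KE LE] := hKL j j1n.
  have K1 : 1 < KB j.
    have := hgainK j j1n; rewrite /gtmx KE -raddfB /=.
    by move/posdefmx_scalar; rewrite subr_gt0.
  have L1 : coriolis_bound m j * M_v s j
      * (1 + 2^-1 * (coriolis_bound m j * M_v s j)) + 2^-1 * KB j < LB j.
    have := hgainL j j1n; rewrite /gtmx KE LE scale_scalar_mx -raddfD -raddfB /=.
    by move/posdefmx_scalar; rewrite subr_gt0.
  have [_ q1 ellE _ _] := hgainq j j1n.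
  have {}q1 : friction_lip m j ^+ 2 + kq g j < 2 * inertia m j * L_q g j.
    by apply: le_lt_trans q1; rewrite le_max lexx orbT.
  have [c c0 rate] := lyapunov_rate hcl j1n KE LE (hMv j j1n) K1 L1 q1 ellE.
  exists c => // t t0; split; first exact: rate.
  by have [] := lyapunov_ge0 hcl j1n (ltW t0).
have [b b0 forcing] := tracking_forcing_le hcl i1n.
have [_ [_ _ _ lam0]] := cl_gains hcl i1n.
apply: (cascade_exponential_decay lam0 b0 c0
  (fun t t0 => is_derive_tracking_error hcl i1n t0)
  (fun t t0 => is_derive_total_lyapunov hcl t0)).
  apply: (total_rate_le hn hcl) => j t j1n t0.
  by have [] := rate j _ t t0; rewrite ?mem_index_iota ?ltnS.
move=> t t0; split; last exact: forcing.
apply: le_trans (lyapunov_le_total hcl i1n t0).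
by have [] := lyapunov_ge0 hcl i1n t0.
Qed.
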